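(* Let $m\in\mathbb{N}$ and $-1<\alpha<0$. The set of Type III exceptional $X_m$-Laguerre polynomials $$\{L_{m,n}^{\mathrm{III},\alpha}\;:\;n=0,m+1,m+2,m+3,\ldots\}$$ forms a complete orthogonal set of polynomials in the Hilbert space $L^2((0,\infty);W_m^{\mathrm{III},\alpha})$.
   Context: $\mathbb{N}=\{1,2,\dots\}$. For $a\in\mathbb{R}$ and integer $n\ge0$ the classical Laguerre polynomial is $L_n^a(x)=\sum_{j=0}^n\binom{n+a}{n-j}\frac{(-x)^j}{j!}$, with $\binom{r}{i}=r(r-1)\cdots(r-i+1)/i!$; $L_n^a:=0$ for $n<0$. The Type III exceptional $X_m$-Laguerre polynomials are $L_{m,0}^{\mathrm{III},\alpha}(x)=1$ and, for $n\ge m+1$, $$L_{m,n}^{\mathrm{III},\alpha}(x)=xL_{n-m-2}^{\alpha+2}(x)L_m^{-\alpha-1}(-x)+(m+1)L_{n-m-1}^{\alpha+1}(x)L_{m+1}^{-\alpha-2}(-x).$$ The Type III weight is $W_m^{\mathrm{III},\alpha}(x)=\dfrac{x^\alpha e^{-x}}{(L_m^{-\alpha-1}(-x))^2}$ on $(0,\infty)$ (for $-1<\alpha<0$, $L_m^{-\alpha-1}(-x)$ has no zeros in $[0,\infty)$). $L^2((0,\infty);W)$ is the Hilbert space of complex-valued measurable $f$ with $\int_0^\infty|f|^2W\,dx<\infty$ with the usual inner product. Complete means that the linear span is dense. *)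

(* Defs.v *)
From HB Require Import structures.
From mathcomp Require Import all_boot all_order all_algebra.
From mathcomp Require Import all_classical all_reals all_analysis.
From mathcomp Require Import complex.
Set Implicit Arguments.
Unset Strict Implicit.
Unset Printing Implicit Defensive.
Import Order.TTheory GRing.Theory Num.Theory.
Import numFieldNormedType.Exports.
Local Open Scope classical_set_scope.
Local Open Scope ring_scope.
Local Open Scope complex_scope.

Section ExceptionalLaguerre.
Variable R : realType.
Implicit Types (r a alpha x : R) (n i m : nat).

Definition gbinom r i : R := (\prod_(k < i) (r - k%:R)) / i`!%:R.

Definition laguerre_nat a n : {poly R} :=
  \poly_(j < n.+1) (gbinom (n%:R + a) (n - j)%N * (-1) ^+ j / j`!%:R).

(* Integer index, because the X_m-Laguerre formula uses L_{-1} = 0. *)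
Definition laguerre a (n : int) : {poly R} :=
  if n is Posz k then laguerre_nat a k else 0.

(* The composition [p \Po (- 'X)] is p(-x). The indices 1 <= n <= m, where the
   polynomial is not defined mathematically, receive an irrelevant value; they
   are excluded by [XIII_index]. *)
Definition XIII_laguerre m alpha n : {poly R} :=
  if n == 0%N then 1 else
    'X * laguerre (alpha + 2) (n%:Z - m%:Z - 2)
       * (laguerre (- alpha - 1) m%:Z \Po (- 'X))
    + m.+1%:R *: (laguerre (alpha + 1) (n%:Z - m%:Z - 1)
                  * (laguerre (- alpha - 2) m.+1%:Z \Po (- 'X))).

Definition XIII_index m : set nat := [set n | n = 0%N \/ (m.+1 <= n)%N].

Definition XIII_weight m alpha x : R :=
  x `^ alpha * expR (- x) / ((laguerre (- alpha - 1) m%:Z).[- x]) ^+ 2.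

Definition poly_Cfun (p : {poly R}) : R -> R[i] := fun x => (p.[x])%:C.

End ExceptionalLaguerre.

(* The space L^2((0,oo); W) is handled through representatives: functions
   R -> R[i] of which only the values on (0,oo) matter. The L^2 distance is a
   pseudometric on representatives, and its dense sets are those whose classes
   modulo a.e. equality are dense in the Hilbert space. *)
Section WeightedL2.
Variables (R : realType) (W : R -> R).
Implicit Types (f g : R -> R[i]) (S : set (R -> R[i])).

Local Notation mu := (@lebesgue_measure R).
Local Notation D := (`]0%R, +oo[%classic : set R).

Definition L2sqnorm f : \bar R :=
  (\int[mu]_(x in D) (Normc.normc (f x) ^+ 2 * W x)%R%:E)%E.

Definition L2 : set (R -> R[i]) := [set f : R -> R[i] |
  [/\ measurable_fun D (fun x => complex.Re (f x)),
      measurable_fun D (fun x => complex.Im (f x)) &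
      (L2sqnorm f < +oo)%E]].

(* Meaningful for f, g in L2, where both integrands are integrable. *)
Definition L2inner f g : R[i] :=
  (\int[mu]_(x in D) (complex.Re (f x * (g x)^*) * W x))%R
  +i* (\int[mu]_(x in D) (complex.Im (f x * (g x)^*) * W x))%R.

(* Members are required to be nonzero in L^2, as usual for an orthogonal set; in particular
   distinct indices give distinct elements of the Hilbert space. *)
Definition orthogonal_family (I : set nat) (e : nat -> R -> R[i]) : Prop :=
  [/\ forall n, I n -> L2 (e n),
      forall n, I n -> (0 < L2sqnorm (e n))%E &
      forall n k, I n -> I k -> n <> k -> L2inner (e n) (e k) = 0].

Definition Cspan S : set (R -> R[i]) := [set f : R -> R[i] |
  exists (n : nat) (c : 'I_n -> R[i]) (g : 'I_n -> R -> R[i]),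
    (forall i, S (g i)) /\ f = (fun x => \sum_(i < n) c i * g i x)].

Definition L2dense S : Prop :=
  forall f, L2 f -> forall eps : R, 0 < eps ->
    exists2 g, S g & (L2sqnorm (fun x => f x - g x)%R < (eps ^+ 2)%R%:E)%E.

Definition L2complete S : Prop := L2dense (Cspan S).

End WeightedL2.

(* Main.v *)
Require Import Defs.
From mathcomp Require Import all_boot all_order all_algebra.
From mathcomp Require Import all_classical all_reals all_analysis.
From mathcomp Require Import measurable_realfun complex ring lra polyrcf.
Set Implicit Arguments.
Unset Strict Implicit.
Unset Printing Implicit Defensive.
Import Order.TTheory GRing.Theory Num.Theory.
Import numFieldNormedType.Exports.
Local Open Scope classical_set_scope.
Local Open Scope ring_scope.

(** Write eta(x) = L_m^{-alpha-1}(-x), W for the weight, which is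
    x^alpha e^{-x} / eta^2, u_k = L_k^{alpha+1}, and n = m + 1 + k. Everything
    rests on two identities satisfied by the exceptional polynomial L_n, both
    consequences of the Laguerre differential equation:

      L_n' = n eta u_k    and    (x^{alpha+1} e^{-x} u_k / eta)' = - W L_n.

    They say that L_n is an eigenfunction of a Sturm-Liouville operator. With
    phi_n = n u_k, and phi_0 = 0 for the constant polynomial, the first one
    reads L_n' = eta phi_n, and the derivative of
    x^{alpha+1} e^{-x} (phi_n L_j - phi_j L_n) / eta is (j - n) W L_n L_j for
    all admissible n and j ([XIII_flux_wronskian]). Since alpha + 1 > 0, that
    function vanishes at 0 and at infinity ([integral_flux0]), and
    orthogonality follows.

    Completeness reduces to a density theorem. The u_k span all polynomials, so
    the first identity shows that the linear span of the family contains every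
    polynomial whose derivative is divisible by eta ([XIII_laguerre_span]), in
    particular every multiple of eta^2. Approximating f by eta^2 p in L2(W) is
    approximating f / eta^2 by p in L2(eta^4 W), so it suffices that the
    polynomials be dense in L2 of the exponentially decaying weight
    eta^4 W = x^alpha e^{-x} eta^2.

    This density holds for every weight w on the half-line such that e^{cx} w
    is integrable for some c > 0 ([polynomials_dense]). For a small h > 0 the
    Taylor polynomials of e^{-hx} converge to it in L2(w), because e^{hx}
    dominates them. As multiplication by e^{-hx} is a contraction, the closure
    of the polynomials is stable under it, and so contains all polynomials in
    t = e^{-hx}. Suitable powers of 1 - t^N converge boundedly to the indicator
    of a ray ]x0, +oo[; a pi-lambda argument extends this to all Borel sets,
    and simple functions do the rest. *)

(** * Laguerre polynomials and the exceptional family *)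

Lemma factr_neq0 (R : realType) n : (n`!%:R : R) != 0.
Proof. by rewrite pnatr_eq0 -lt0n fact_gt0. Qed.

Lemma gbinom_recl (R : realType) (r : R) i :
  gbinom r i.+1 * i.+1%:R = gbinom r i * (r - i%:R).
Proof.
rewrite /gbinom big_ord_recr /= factS natrM invfM.
have ? := factr_neq0 R i.
have : (i.+1%:R : R) != 0 by rewrite pnatr_eq0.
move: (\prod_(_ < _) _) => P ?; by field; apply/andP.
Qed.

Lemma deriv_laguerre_nat (R : realType) (a : R) n :
  (laguerre_nat a n.+1)^`() = - laguerre_nat (a + 1) n.
Proof.
apply/polyP => j; rewrite coef_deriv coefN !coef_poly ltnS.
case: ifP => [_|]; last by rewrite mul0rn oppr0.
rewrite subSS factS natrM (_ : n.+1%:R + a = n%:R + (a + 1)); last first.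
  by rewrite -natr1; ring.
rewrite exprS -[X in X = _]mulr_natr.
have ? := factr_neq0 R j.
have ? : (j.+1%:R : R) != 0 by rewrite pnatr_eq0.
by field; apply/andP.
Qed.

Lemma deriv_laguerre_nat0 (R : realType) (a : R) : (laguerre_nat a 0)^`() = 0.
Proof.
by apply/polyP => j; rewrite coef_deriv coef_poly ltnS coef0 mul0rn.
Qed.

Lemma laguerre_nat_ode (R : realType) (a : R) n (L := laguerre_nat a n) :
  'X * L^`()^`() + ((a + 1)%:P - 'X) * L^`() + n%:R *: L = 0.
Proof.
apply/polyP => j; rewrite mulrBl mul_polyC !coefD coefN !coefZ !coefXM coef0.
rewrite !coef_deriv !coef_poly.
have key : (j < n)%N ->
   gbinom (n%:R + a) (n - j.+1) * (a + 1 + j%:R) =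
   gbinom (n%:R + a) (n - j) * (n%:R - j%:R).
  move=> jn; rewrite -natrB; last exact: ltnW.
  rewrite -[in RHS](subnSK jn) gbinom_recl natrB// -[j.+1%:R]natr1.
  by congr (_ * _); ring.
case: j key => [|j] key /=.
  case: n L key => [|n] L key.
    by rewrite /= !mul0rn !mulr0 mul0r !addr0 ?subr0 ?add0r ?oppr0.
  have := key isT; rewrite subn1 subn0 /= !mulr1n.
  rewrite ?expr1 ?expr0 ?factS ?fact0 ?mulr1 ?add0r => E.
  transitivity (gbinom (n.+1%:R + a) n.+1 * (n.+1%:R - 0)
                - gbinom (n.+1%:R + a) n * (a + 1 + 0)); last by rewrite E subrr.
  by field.
rewrite !ltnS; case: (ltngtP j.+1 n) => [jn|jn|jn].
- rewrite -!(mulr_natr (_ * _)).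
  have := key jn.
  have f0 := factr_neq0 R j.
  have j1 : (j.+1%:R : R) != 0 by rewrite pnatr_eq0.
  have j2 : (j.+2%:R : R) != 0 by rewrite pnatr_eq0.
  rewrite !factS !natrM !exprS; move: (gbinom _ _) (gbinom _ _) => B A E.
  apply: (@mulfI _ (j`!%:R * j.+1%:R)); first by rewrite mulf_neq0.
  rewrite mulr0.
  transitivity ((-1)^+j * (A * (a + 1 + j.+1%:R) - B * (n%:R - j.+1%:R))).
    rewrite -[j.+2%:R]natr1 in j2 *.
    rewrite -[j.+1%:R]natr1 in j1 j2 *.
    by field; rewrite !andbA; apply/andP; split=> //; apply/andP.
  by rewrite E subrr mulr0.
- by rewrite !mul0rn !mulr0 subrr !addr0.
- by rewrite -jn !mul0rn -!(mulr_natr (_ * _)); ring.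
Qed.

Definition reflected_laguerre (R : realType) (a : R) n : {poly R} :=
  laguerre_nat a n \Po (- 'X).

Lemma deriv_reflected_laguerre (R : realType) (a : R) n :
  (reflected_laguerre a n.+1)^`() = reflected_laguerre (a + 1) n.
Proof.
rewrite /reflected_laguerre deriv_comp deriv_laguerre_nat derivN derivX.
by rewrite mulrN1 raddfN/= opprK.
Qed.

Lemma reflected_laguerre_ode (R : realType) (a : R) n (y := reflected_laguerre a n) :
  n%:R *: y = 'X * y^`()^`() + ((a + 1)%:P + 'X) * y^`().
Proof.
have := congr1 (fun p => p \Po (- 'X)) (laguerre_nat_ode a n).
rewrite /= comp_poly0 !comp_polyD !comp_polyM comp_polyZ comp_polyB comp_polyC.
rewrite comp_polyX /y /reflected_laguerre !(deriv_comp, derivM, derivN, derivX).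
rewrite derivC oppr0 mulr0 addr0 => /eqP.
by rewrite addr_eq0 eq_sym eqr_oppLR => /eqP ->; ring.
Qed.

Lemma laguerre_reflectedE (R : realType) (a : R) n :
  laguerre a n%:Z \Po (- 'X) = reflected_laguerre a n.
Proof. by []. Qed.

(** The integer index lets k = 0 be covered: both sides are then 0. *)
Lemma deriv_laguerre (R : realType) (a : R) k :
  (laguerre_nat (a + 1) k)^`() = - laguerre (a + 2) (k%:Z - 1).
Proof.
case: k => [|k]; first by rewrite deriv_laguerre_nat0 oppr0.
rewrite deriv_laguerre_nat -addrA (_ : 1 + 1 = 2%:R) //.
by rewrite (_ : k.+1%:Z - 1 = k%:Z)// -addn1 PoszD addrK.
Qed.

(** The polynomial L_{m+1}^{-alpha-2}(-x) in the definition is a primitive of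
    eta, and the differential equation expresses it through eta and eta'. *)
Lemma XIII_laguerreE (R : realType) (alpha : R) m k
    (u := laguerre_nat (alpha + 1) k)
    (eta := reflected_laguerre (- alpha - 1) m) :
  XIII_laguerre m alpha (m.+1 + k) =
  u * ('X * eta^`() + ('X - (alpha + 1)%:P) * eta) - 'X * u^`() * eta.
Proof.
have xi_eta : m.+1%:R *: reflected_laguerre (- alpha - 2) m.+1 =
    'X * eta^`() + ('X - (alpha + 1)%:P) * eta.
  rewrite reflected_laguerre_ode deriv_reflected_laguerre.
  rewrite (_ : - alpha - 2 + 1 = - alpha - 1); last by ring.
  by rewrite -/eta -opprD polyCN; ring.
rewrite /XIII_laguerre /= -xi_eta.
have -> : (m.+1 + k)%:Z - m%:Z - 2 = k%:Z - 1.
  by rewrite PoszD -addn1 PoszD; ring.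
have -> : (m.+1 + k)%:Z - m%:Z - 1 = k%:Z.
  by rewrite PoszD -addn1 PoszD; ring.
rewrite deriv_laguerre !laguerre_reflectedE -/eta -scalerAr.
rewrite mulrN mulNr opprK addrC; congr (_ + _).
Qed.

(** The equation for u turns the part of second order in u into k u eta; the one
    for eta says that the factor of u in [XIII_laguerreE] has derivative
    (m + 1) eta. *)
Lemma deriv_XIII_laguerre (R : realType) (alpha : R) m k :
  (XIII_laguerre m alpha (m.+1 + k))^`() = (m.+1 + k)%:R *:
    (reflected_laguerre (- alpha - 1) m * laguerre_nat (alpha + 1) k).
Proof.
rewrite XIII_laguerreE.
set eta := reflected_laguerre _ _; set u := laguerre_nat _ _.
have Eu := laguerre_nat_ode (alpha + 1) k; rewrite -/u /= in Eu.
have Ee := reflected_laguerre_ode (- alpha - 1) m; rewrite -/eta /= in Ee.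
rewrite !(derivM, derivD, derivN, derivX, derivC).
have -> : (m.+1 + k)%:R *: (eta * u) = u * (eta + m%:R *: eta) + eta * (k%:R *: u).
  by rewrite natrD -natr1 -!mul_polyC !polyCD; ring.
rewrite Ee; have -> : k%:R *: u = - ('X * u^`()^`() + ((alpha + 1 + 1)%:P - 'X) * u^`()).
  by apply/eqP; rewrite -addr_eq0 addrC Eu.
by rewrite !polyCD !polyCN; ring.
Qed.

Lemma size_laguerre_nat (R : realType) (a : R) k :
  size (laguerre_nat a k) = k.+1.
Proof.
apply: size_poly_eq; rewrite subnn /gbinom big_ord0 fact0 divr1 mul1r.
by rewrite mulf_neq0 ?invr_eq0 ?factr_neq0// signr_eq0.
Qed.

(** The leading terms have all degrees, so the Laguerre polynomials of any
    fixed parameter form a basis. *)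
Lemma laguerre_nat_span (R : realType) (a : R) N (q : {poly R}) :
  (size q <= N)%N ->
  exists c : nat -> R, q = \sum_(i < N) c i *: laguerre_nat a i.
Proof.
elim: N q => [|N IH] q.
  by rewrite leqn0 size_poly_eq0 => /eqP ->; exists (fun=> 0); rewrite big_ord0.
move=> sq; pose L := laguerre_nat a N; pose b := q`_N / L`_N.
have LN0 : L`_N != 0.
  have := lead_coef_eq0 L; rewrite lead_coefE size_laguerre_nat /= => ->.
  by rewrite -size_poly_eq0 size_laguerre_nat.
have /IH[c Hc] : (size (q - b *: L)%R <= N)%N.
  apply/leq_sizeP => j; rewrite leq_eqVlt => /predU1P[<-|Nj].
    by rewrite coefB coefZ /b divfK// subrr.
  rewrite coefB coefZ [q`_j]nth_default ?(leq_trans sq)//.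
  by rewrite [L`_j]nth_default ?size_laguerre_nat// mulr0 subrr.
exists (fun i => if i == N then b else c i).
rewrite big_ord_recr /= eqxx -/L -[LHS](subrK (b *: L)) Hc; congr (_ + _).
by apply: eq_bigr => i _; rewrite ltn_eqF.
Qed.

Lemma deriv_eq0_const (R : realType) (p : {poly R}) : p^`() = 0 -> p = (p`_0)%:P.
Proof.
move=> p0; apply/polyP => -[|j]; rewrite coefC//=.
have := congr1 (fun q : {poly R} => q`_j) p0.
by rewrite coef_deriv coef0 => /eqP; rewrite mulrn_eq0 => /eqP.
Qed.

(** Skips the gap 1, ..., m, so that finite sums over the family are indexed by
    an initial segment of nat. *)
Definition XIII_enum m i : nat := if i is k.+1 then (m.+1 + k)%N else 0%N.

Lemma XIII_enumP m i : XIII_index m (XIII_enum m i).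
Proof. by case: i => [|i]; [left|right; exact: leq_addr]. Qed.

(** Both sides have derivative eta q once q is expanded in the u_k; the
    constant polynomial of the family absorbs the constant of integration. *)
Lemma XIII_laguerre_span (R : realType) (alpha : R) m N (q r : {poly R})
    (eta := reflected_laguerre (- alpha - 1) m) :
  (size q <= N)%N -> r^`() = eta * q ->
  exists c : nat -> R,
    r = \sum_(i < N.+1) c i *: XIII_laguerre m alpha (XIII_enum m i).
Proof.
move=> sq r'; have [c qE] := laguerre_nat_span (alpha + 1) sq.
pose s := \sum_(i < N) (c i / (m.+1 + i)%:R) *: XIII_laguerre m alpha (m.+1 + i).
have s' : s^`() = r^`().
  rewrite r' qE mulr_sumr raddf_sum; apply: eq_bigr => i _.
  by rewrite /= derivZ deriv_XIII_laguerre scalerA divfK -?scalerAr.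
have rs : (r - s)^`() = 0 by rewrite derivB s' subrr.
exists (fun i => if i is k.+1 then c k / (m.+1 + k)%:R else (r - s)`_0).
rewrite big_ord_recl /= {1}/XIII_laguerre /= alg_polyC -deriv_eq0_const//.
by rewrite subrK.
Qed.

Lemma gbinom_gt0 (R : realType) (r : R) i :
  (forall k, (k < i)%N -> k%:R < r) -> 0 < gbinom r i.
Proof.
move=> kr; rewrite /gbinom divr_gt0 ?ltr0n ?fact_gt0//.
by apply: prodr_gt0 => k _; rewrite subr_gt0 kr.
Qed.

Lemma horner_reflected_laguerre (R : realType) (a : R) m x :
  (reflected_laguerre a m).[x] =
  \sum_(j < m.+1) gbinom (m%:R + a) (m - j) / j`!%:R * x ^+ j.
Proof.
rewrite /reflected_laguerre horner_comp hornerN hornerX /laguerre_nat.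
rewrite horner_poly; apply: eq_bigr => j _.
by rewrite (exprNn x) -[RHS]mulr1 -[X in _ = _ * X](sqrr_sign R j) expr2; ring.
Qed.

Lemma gbinom_natD_gt0 (R : realType) (a : R) m i : -1 < a -> (i <= m)%N ->
  0 < gbinom (m%:R + a) i.
Proof.
move=> a1 im; apply: gbinom_gt0 => k ki.
have : k%:R + 1 <= m%:R :> R by rewrite natr1 ler_nat (leq_trans ki).
lra.
Qed.

(** For a > -1 all the coefficients are positive: the constant one bounds the
    polynomial away from zero on the half-line. *)
Lemma reflected_laguerre_ge (R : realType) (a : R) m x : -1 < a -> 0 <= x ->
  gbinom (m%:R + a) m <= (reflected_laguerre a m).[x].
Proof.
move=> a1 x0; rewrite horner_reflected_laguerre big_ord_recl subn0 fact0.
rewrite divr1 expr0 mulr1 lerDl; apply: sumr_ge0 => j _.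
by rewrite mulr_ge0 ?exprn_ge0// divr_ge0// ltW// gbinom_natD_gt0// leq_subr.
Qed.

(** * Density of polynomials in weighted L2 spaces *)

Lemma measurable_horner (R : realType) (D : set R) (p : {poly R}) :
  measurable_fun D (fun x => p.[x]).
Proof.
apply: measurable_funTS; apply: continuous_measurable_fun.
exact: continuous_horner.
Qed.

(** Each factor x is absorbed by half of the exponential. *)
Lemma horner_le_expR (R : realType) (p : {poly R}) (d : R) : 0 < d ->
  exists2 M, 0 <= M & forall x, 0 <= x -> `|p.[x]| <= M * expR (d * x).
Proof.
elim/poly_ind: p d => [|p c IH] d d0.
  by exists 0 => // x _; rewrite horner0 normr0 mul0r.
have [M M0 HM] := IH (d / 2) (divr_gt0 d0 (ltr0Sn _ _)).
exists (M * (2 / d) + `|c|) => [|x x0].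
  by rewrite addr_ge0// mulr_ge0// divr_ge0// ltW.
rewrite hornerMXaddC (le_trans (ler_normD _ _))// mulrDl lerD//; last first.
  by rewrite ler_peMr// (le_trans _ (expR_ge1Dx _))// lerDl mulr_ge0// ltW.
rewrite normrM (ger0_norm x0) (_ : d * x = d / 2 * x + d / 2 * x); last by field.
rewrite expRD [leRHS](_ : _ = (M * expR (d / 2 * x)) * (2 / d * expR (d / 2 * x))); last by ring.
apply: ler_pM => //; first exact: HM.
rewrite mulrAC ler_pdivlMr// -ler_pdivrMl//.
rewrite (le_trans _ (expR_ge1Dx _))// (_ : 2^-1 * (x * d) = d / 2 * x); last by field.
by rewrite lerDr.
Qed.

Section WeightedApproximation.
Variables (R : realType) (w : R -> R).
Local Notation mu := (@lebesgue_measure R).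
Local Notation D := (`]0%R, +oo[%classic : set R).
Hypotheses (mw : measurable_fun D w) (w0 : forall x, D x -> 0 <= w x).
Implicit Types f g h : R -> R.

Definition sqdist f g : \bar R :=
  (\int[mu]_(x in D) ((f x - g x) ^+ 2 * w x)%:E)%E.

(** Membership in the L2(w)-closure of the polynomials. Measurability is bundled
    so that the closure properties carry no side conditions. *)
Definition poly_approx f : Prop := measurable_fun D f /\
  forall eps : R, 0 < eps -> exists p : {poly R}, (sqdist f (horner p) < eps%:E)%E.

Let mD : measurable D. Proof. by []. Qed.

Lemma measurable_sqdist f g : measurable_fun D f -> measurable_fun D g ->
  measurable_fun D (fun x => ((f x - g x) ^+ 2 * w x)%:E).
Proof.
move=> mf mg; apply/measurable_EFinP; apply: measurable_funM => //.
by apply: measurable_funX; exact: measurable_funB.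
Qed.

Lemma sqdist_integrand_ge0 f g x : D x -> (0 <= ((f x - g x) ^+ 2 * w x)%:E)%E.
Proof. by move=> Dx; rewrite lee_fin mulr_ge0 ?sqr_ge0 ?w0. Qed.

Lemma le_sqdist (k : R) f g f' g' : 0 <= k ->
  measurable_fun D f -> measurable_fun D g ->
  measurable_fun D f' -> measurable_fun D g' ->
  (forall x, D x -> (f x - g x) ^+ 2 <= k * (f' x - g' x) ^+ 2) ->
  (sqdist f g <= k%:E * sqdist f' g')%E.
Proof.
move=> k0 mf mg mf' mg' le; rewrite /sqdist -ge0_integralZl//; last 2 first.
- exact: measurable_sqdist.
- exact: sqdist_integrand_ge0.
apply: ge0_le_integral => //.
- exact: sqdist_integrand_ge0.
- exact: measurable_sqdist.
- by apply: measurable_funeM; exact: measurable_sqdist.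
- by move=> x Dx; rewrite -EFinM lee_fin mulrA ler_wpM2r ?w0// le.
Qed.

(** (a + b)^2 <= 2 a^2 + 2 b^2: a triangle inequality for the squared distance
    that is cheap to prove and suffices for closure arguments. *)
Lemma sqdist_triangle g f h : measurable_fun D f -> measurable_fun D g ->
  measurable_fun D h ->
  (sqdist f h <= 2%:E * (sqdist f g + sqdist g h))%E.
Proof.
move=> mf mg mh; rewrite /sqdist -ge0_integralD//; last 4 first.
- exact: sqdist_integrand_ge0.
- exact: measurable_sqdist.
- exact: sqdist_integrand_ge0.
- exact: measurable_sqdist.
rewrite -ge0_integralZl//; last 2 first.
- by apply: emeasurable_funD; exact: measurable_sqdist.
- by move=> x Dx; rewrite adde_ge0// sqdist_integrand_ge0.
apply: ge0_le_integral => //.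
- exact: sqdist_integrand_ge0.
- exact: measurable_sqdist.
- by apply: measurable_funeM; apply: emeasurable_funD; exact: measurable_sqdist.
- move=> x Dx; rewrite -EFinD -EFinM lee_fin -mulrDl mulrA ler_wpM2r ?w0//.
  have := sqr_ge0 (f x - 2 * g x + h x); rewrite -subr_ge0 => ?; nra.
Qed.

Lemma approx_of_approx f : measurable_fun D f ->
  (forall eps : R, 0 < eps ->
     exists2 g, poly_approx g & (sqdist f g < eps%:E)%E) ->
  poly_approx f.
Proof.
move=> mf af; split=> // eps e0; have e4 : 0 < eps / 4 by rewrite divr_gt0.
have [g [mg ag] fg] := af _ e4; have [p gp] := ag _ e4; exists p.
rewrite (le_lt_trans (sqdist_triangle mf mg _))//; first exact: measurable_horner.
rewrite (_ : eps = 2 * (eps / 4 + eps / 4)); last by field.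
by rewrite EFinM (EFinD (eps / 4)) lte_pmul2l ?lte_fin// lteD.
Qed.

Lemma poly_approx_poly (p : {poly R}) : poly_approx (horner p).
Proof.
split=> [|eps e0]; first exact: measurable_horner.
exists p; rewrite /sqdist integral0_eq ?lte_fin// => x _.
by rewrite subrr expr0n mul0r.
Qed.

Lemma poly_approxZ (a : R) f : poly_approx f -> poly_approx (fun x => a * f x).
Proof.
move=> [mf af]; have maf : measurable_fun D (fun x => a * f x).
  by apply: measurable_funM.
split=> // eps e0; have a1 : 0 < a ^+ 2 + 1 by rewrite ltr_wpDl ?sqr_ge0.
have [p fp] := af _ (divr_gt0 e0 a1); exists (a *: p).
have /le_lt_trans : (sqdist (fun x => (a * f x)%R) (horner (a *: p)%R) <=
    (a ^+ 2 + 1)%:E * sqdist f (horner p))%E.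
  apply: le_sqdist => //; try exact: measurable_horner; first exact: ltW.
  move=> x _; rewrite hornerZ -mulrBr exprMn ler_wpM2r ?sqr_ge0//.
  by rewrite lerDl.
apply; rewrite (_ : eps = (a ^+ 2 + 1) * (eps / (a ^+ 2 + 1))).
  by rewrite EFinM lte_pmul2l.
by rewrite mulrC divfK// gt_eqF.
Qed.

Lemma poly_approxD f g : poly_approx f -> poly_approx g ->
  poly_approx (fun x => f x + g x).
Proof.
move=> [mf af] [mg ag]; split=> [|eps e0]; first exact: measurable_funD.
have e4 : 0 < eps / 4 by rewrite divr_gt0.
have [p fp] := af _ e4; have [q gq] := ag _ e4; exists (p + q).
have mfq : measurable_fun D (fun x => p.[x] + g x).
  by apply: measurable_funD => //; exact: measurable_horner.
rewrite (le_lt_trans (sqdist_triangle _ mfq _))//.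
- exact: measurable_funD.
- exact: measurable_horner.
rewrite (_ : eps = 2 * (eps / 4 + eps / 4)); last by field.
rewrite EFinM (EFinD (eps / 4)) lte_pmul2l ?lte_fin// lteD//.
- congr (_ < _)%E : fp; apply: eq_integral => x _; congr ((_ ^+ 2 * _)%:E); ring.
- congr (_ < _)%E : gq; apply: eq_integral => x _; rewrite hornerD.
  by congr ((_ ^+ 2 * _)%:E); ring.
Qed.

Lemma eq_poly_approx f g : {in D, f =1 g} -> poly_approx f -> poly_approx g.
Proof.
move=> fg [mf af]; split=> [|eps e0]; first exact: eq_measurable_fun mf.
have [p fp] := af _ e0; exists p; congr (_ < _)%E : fp.
by apply: eq_integral => x Dx; rewrite fg.
Qed.

Lemma poly_approx_sum (I : Type) (s : seq I) (F : I -> R -> R) :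
  (forall i, poly_approx (F i)) -> poly_approx (fun x => \sum_(i <- s) F i x).
Proof.
move=> aF; elim: s => [|i s IH].
  apply: (@eq_poly_approx (horner 0)); last exact: poly_approx_poly.
  by move=> x _; rewrite horner0 big_nil.
apply: eq_poly_approx (poly_approxD (aF i) IH) => x _.
by rewrite big_cons.
Qed.

(** The closure is stable under dominated convergence: this yields in turn
    e^{-hx}, the indicators of rays, increasing unions and nonnegative
    functions. *)
Lemma poly_approx_lim f (g_ : nat -> R -> R) (B : R -> R) :
  mu.-integrable D (EFin \o B) -> measurable_fun D f ->
  (forall n, poly_approx (g_ n)) ->
  (forall x, D x -> g_ ^~ x @ \oo --> f x) ->
  (forall n x, D x -> (f x - g_ n x) ^+ 2 * w x <= B x) ->
  poly_approx f.
Proof.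
move=> iB mf ag gf gB; apply: approx_of_approx => // eps e0.
have cv0 x : D x -> (fun n => ((f x - g_ n x) ^+ 2 * w x)%:E) @ \oo --> (cst 0%E x : \bar R).
  move=> Dx; rewrite /cst; apply: cvg_EFin; first exact: nearW.
  have d0 : (fun n => f x - g_ n x) @ \oo --> 0.
    by rewrite -(subrr (f x)); apply: cvgB; [exact: cvg_cst|exact: gf].
  by have := cvgM (cvgM d0 d0) (cvg_cst (w x)); rewrite !mul0r; apply.
have dom n x : D x -> (`|((f x - g_ n x) ^+ 2 * w x)%:E| <= (EFin \o B) x)%E.
  move=> Dx; rewrite gee0_abs; last exact: sqdist_integrand_ge0.
  by rewrite lee_fin gB.
have [|||||_ _] := @dominated_convergence _ _ _ mu D mD
  (fun n x => ((f x - g_ n x) ^+ 2 * w x)%:E) (cst 0%E) (EFin \o B).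
- by move=> n; apply: measurable_sqdist => //; case: (ag n).
- exact: measurable_cst.
- exact: aeW.
- exact: iB.
- by apply: aeW => x n; exact: dom.
rewrite integral0 => /(_ _ (open_ereal_lt' _))/= lt0.
have : (0 < eps%:E)%E by rewrite lte_fin.
by move=> /lt0 [N _ /(_ N (leqnn _))] lte; exists (g_ N).
Qed.

End WeightedApproximation.

Lemma cvg_le_harmonic (R : realType) (u : nat -> R) (l K : R) :
  (forall n, `|l - u n| <= K / n.+1%:R) -> u @ \oo --> l.
Proof.
move=> uK; have H0 : (fun n => K * harmonic n) @ \oo --> 0.
  rewrite -(mulr0 K); apply: cvgM; [exact: cvg_cst|exact: cvg_harmonic].
apply/cvgrPdist_le => e e0.
have /cvgrPdist_le/(_ e e0) := H0; apply: filterS => n.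
rewrite sub0r normrN => Kn; apply: le_trans (uK n) _.
exact: le_trans (ler_norm _) Kn.
Qed.

Definition exp_taylor (R : realType) (s : R) N : {poly R} :=
  \poly_(i < N) (s ^+ i / i`!%:R).

Lemma horner_exp_taylor (R : realType) (s x : R) N :
  (exp_taylor s N).[x] = series (exp_coeff (s * x)) N.
Proof.
rewrite horner_poly /series /= big_mkord; apply: eq_bigr => i _.
by rewrite /exp_coeff /= exprMn mulrAC.
Qed.

Lemma norm_exp_taylor_le (R : realType) (s x : R) N :
  `|(exp_taylor s N).[x]| <= expR `|s * x|.
Proof.
rewrite horner_exp_taylor /series /= (le_trans (ler_norm_sum _ _ _))//.
have := @nondecreasing_cvgn_le _ (series (exp_coeff `|s * x|)).
move=> /(_ _ (is_cvg_series_exp_coeff _) N) le.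
rewrite (le_trans _ (le _))//.
  by apply: ler_sum => i _; rewrite /exp_coeff /= normrM normrX [`|_^-1|]ger0_norm.
apply/nondecreasing_seqP => n; rewrite /series /= big_nat_recr//= lerDl.
by rewrite /exp_coeff /= divr_ge0// exprn_ge0.
Qed.

Lemma bernoulli_ineq (R : realType) (s : R) n : 0 <= s <= 1 ->
  1 - n%:R * s <= (1 - s) ^+ n.
Proof.
move=> /andP[s0 s1]; elim: n => [|n IH]; first by rewrite mul0r subr0.
rewrite exprS (le_trans _ (ler_wpM2l _ IH)) ?subr_ge0//.
rewrite -natr1 -subr_ge0 (_ : _ - _ = n%:R * s ^+ 2); last by ring.
by rewrite mulr_ge0 ?sqr_ge0.
Qed.

(** The factor n.+1 makes the convergence below hold at the jump x0 as well. *)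
Definition smooth_step_exponent (R : realType) (h x0 : R) n : nat :=
  (Num.truncn (n.+1%:R * expR (n.+1%:R * (h * x0)))).+1.

(** With N = n.+1, t = e^{-hx} and t0 = e^{-h x0}, the exponent grows like
    N t0^{-N}, hence its product with t^N tends to 0 for t < t0 and to infinity
    for t >= t0; accordingly (1 - t^N)^E tends to 1 or to 0. *)
Lemma smooth_step_cvg (R : realType) (h x0 x : R) : 0 < h -> 0 < x ->
  (fun n => (1 - expR (- h * x) ^+ n.+1) ^+ smooth_step_exponent h x0 n) @ \oo -->
  (\1_(`]x0, +oo[%classic) x : R).
Proof.
move=> h0 xgt0; rewrite indicE.
have sE n : expR (- h * x) ^+ n.+1 = expR (- (n.+1%:R * (h * x))).
  by rewrite -expRM_natl; congr expR; ring.
have s0 n : 0 <= expR (- h * x) ^+ n.+1 by rewrite exprn_ge0 ?expR_ge0.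
have s1 n : expR (- h * x) ^+ n.+1 <= 1.
  by rewrite sE expR_le1 oppr_le0 !mulr_ge0 // ltW.
have N0 n : 0 < n.+1%:R :> R by rewrite ltr0n.
have Ege n : n.+1%:R * expR (n.+1%:R * (h * x0)) <= (smooth_step_exponent h x0 n)%:R.
  by rewrite ltW// truncnS_gt.
have Ele n : (smooth_step_exponent h x0 n)%:R <= n.+1%:R * expR (n.+1%:R * (h * x0)) + 1.
  rewrite /smooth_step_exponent; set y := _ * expR _.
  rewrite -[(Num.truncn y).+1%:R]natr1 lerD2r truncn_le.
  by rewrite mulr_ge0 ?expR_ge0.
case: (leP x x0) => [xx0|x0x].
- rewrite memNset/=; last by rewrite in_itv/= andbT => /(le_lt_trans xx0); rewrite ltxx.
  apply: (@cvg_le_harmonic _ _ _ 1) => n.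
  rewrite sub0r normrN ger0_norm ?exprn_ge0 ?subr_ge0// mul1r.
  have : 1 - expR (- h * x) ^+ n.+1 <= expR (- expR (- h * x) ^+ n.+1).
    exact: expR_ge1Dx.
  move=> /(lerXn2r (smooth_step_exponent h x0 n)) => /(_ _ _)/le_trans; apply.
  + by rewrite nnegrE subr_ge0.
  + by rewrite nnegrE expR_ge0.
  rewrite -(expRM_natl _ (- _)) mulrN expRN lef_pV2 ?posrE ?expR_gt0//.
  apply: le_trans (expR_ge1Dx _); rewrite -[leLHS]add0r lerD//.
  apply: le_trans (ler_wpM2r (s0 n) (Ege n)).
  rewrite -mulrA sE -expRD ler_peMr ?ltr0n ?ler0n// -[leLHS]expR0 ler_expR.
  by rewrite -mulrBr -mulrBr mulr_ge0// mulr_ge0// ?subr_ge0// ltW.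
- rewrite mem_set/=; last by rewrite in_itv/= andbT.
  pose d := h * (x - x0); have d0 : 0 < d by rewrite mulr_gt0// subr_gt0.
  have hx0 : 0 < h * x by rewrite mulr_gt0.
  apply: (@cvg_le_harmonic _ _ _ (2 / d ^+ 2 + (h * x)^-1)) => n.
  set s := expR (- h * x) ^+ n.+1 in s0 s1 *.
  have p1 : (1 - s) ^+ smooth_step_exponent h x0 n <= 1.
    by rewrite exprn_ile1// ?subr_ge0 ?s1// lerBlDr lerDl s0.
  rewrite ger0_norm ?subr_ge0//.
  have le1 : 1 - (1 - s) ^+ smooth_step_exponent h x0 n <= (smooth_step_exponent h x0 n)%:R * s.
    by rewrite lerBlDl -lerBlDr bernoulli_ineq// s0 s1.
  apply: le_trans le1 _.
  apply: le_trans (ler_wpM2r (s0 n) (Ele n)) _.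
  rewrite mulrDl mul1r mulrDl lerD//.
    rewrite -mulrA /s sE -expRD -mulrBr -mulrBr -opprB !mulrN -/d expRN.
    have y0 : 0 < n.+1%:R * d by rewrite mulr_gt0.
    have := expR_ge1Dxn 1 (ltW y0); rewrite (_ : 2`!%:R = 2%:R)// => ey.
    rewrite ler_pdivrMr ?expR_gt0// -ler_pdivrMl ?mulr_gt0 ?divr_gt0 ?invr_gt0 ?exprn_gt0//.
    apply: le_trans ey; rewrite -[leLHS]add0r lerD//.
    by rewrite le_eqVlt; apply/orP; left; apply/eqP; field; rewrite !gt_eqF.
  rewrite /s sE expRN -invfM lef_pV2 ?posrE ?expR_gt0 ?mulr_gt0// mulrC.
  by apply: le_trans (expR_ge1Dx _); rewrite lerDr.
Qed.

Section PolynomialDensity.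
Variables (R : realType) (w : R -> R) (c : R).
Local Notation mu := (@lebesgue_measure R).
Local Notation D := (`]0%R, +oo[%classic : set R).
Hypotheses (mw : measurable_fun D w) (w0 : forall x, D x -> 0 <= w x).
Hypotheses (c0 : 0 < c)
  (iw : mu.-integrable D (fun x => (expR (c * x) * w x)%:E)).
Implicit Types f g : R -> R.

(* The squared Taylor remainder costs e^{2hx}, and the square of a polynomial
   another e^{2hx}. *)
Let h := c / 4.
Let h0 : 0 < h. Proof. by rewrite divr_gt0. Qed.

Let in_D x : D x -> 0 < x. Proof. by rewrite /= in_itv/= andbT. Qed.

Let integrable_majorant M :
  mu.-integrable D (EFin \o (fun x => M * (expR (c * x) * w x))).
Proof. by have := @integrableZl _ _ R mu D ltac:(by []) M _ iw. Qed.

Let measurable_expRh : measurable_fun D (fun x : R => expR (- h * x)).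
Proof.
by apply: measurableT_comp => //; exact: measurable_funM.
Qed.

Let expRh_le1 x : D x -> expR (- h * x) <= 1.
Proof. by move=> /in_D x0; rewrite expR_le1 mulNr oppr_le0 mulr_ge0// ltW. Qed.

(** The Taylor polynomials of e^{-hx} are dominated by e^{hx}, which the weight
    absorbs because h was chosen small against c. *)
Lemma poly_approx_expR (p : {poly R}) :
  poly_approx w (fun x => expR (- h * x) * p.[x]).
Proof.
have [M M0 pM] := horner_le_expR p h0.
apply: (poly_approx_lim mw w0
  (g_ := fun N => horner (exp_taylor (- h) N * p)) (integrable_majorant (4 * M ^+ 2))).
- by apply: measurable_funM => //; exact: measurable_horner.
- by move=> n; exact: poly_approx_poly.
- move=> x Dx; under eq_fun do rewrite hornerM horner_exp_taylor.
  apply: cvgM; last exact: cvg_cst.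
  exact: is_cvg_series_exp_coeff.
- move=> N x Dx; have x0 := in_D Dx.
  rewrite hornerM -mulrBl mulrA ler_wpM2r ?w0//.
  have dist : `|expR (- h * x) - (exp_taylor (- h) N).[x]| <= 2 * expR (h * x).
    rewrite mulr_natl mulr2n (le_trans (ler_normB _ _))// lerD//.
      rewrite ger0_norm ?expR_ge0// (le_trans (expRh_le1 Dx))//.
      by rewrite -[leLHS]expR0 ler_expR mulr_ge0// ltW.
    rewrite (le_trans (norm_exp_taylor_le _ _ _))// ler_expR mulNr normrN.
    by rewrite ger0_norm// mulr_ge0// ltW.
  have : `|(expR (- h * x) - (exp_taylor (- h) N).[x]) * p.[x]|
      <= (2 * expR (h * x)) * (M * expR (h * x)).
    by rewrite normrM ler_pM// pM// ltW.
  move=> /(lerXn2r 2) => /(_ _ _); rewrite !nnegrE real_normK ?num_real//.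
  move=> /(_ _ _)/le_trans; apply=> //.
    by rewrite !mulr_ge0 ?expR_ge0.
  rewrite (_ : c * x = h * x + h * x + h * x + h * x); last by rewrite /h; field.
  by rewrite !expRD le_eqVlt; apply/orP; left; apply/eqP; ring.
Qed.

(** Multiplication by e^{-hx} <= 1 does not increase distances. *)
Lemma poly_approx_mul_expR f : poly_approx w f ->
  poly_approx w (fun x => expR (- h * x) * f x).
Proof.
move=> [mf af]; apply: (approx_of_approx mw w0) => [|eps e0].
  exact: measurable_funM.
have [p fp] := af _ e0; exists (fun x => expR (- h * x) * p.[x]).
  exact: poly_approx_expR.
apply: le_lt_trans fp; rewrite -[leRHS]mul1e.
apply: (le_sqdist mw w0) => //; try exact: measurable_horner.
- exact: measurable_funM.
- by apply: measurable_funM => //; exact: measurable_horner.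
- move=> x Dx; rewrite mul1r -mulrBr exprMn ler_piMl ?sqr_ge0//.
  by rewrite exprn_ile1// expRh_le1.
Qed.

Lemma poly_approx_pow N E :
  poly_approx w (fun x => (1 - expR (- h * x) ^+ N) ^+ E).
Proof.
have mulX f n : poly_approx w f ->
    poly_approx w (fun x => expR (- h * x) ^+ n * f x).
  move=> af; elim: n => [|n IH].
    by apply: eq_poly_approx af => x _; rewrite expr0 mul1r.
  by apply: eq_poly_approx (poly_approx_mul_expR IH) => x _; rewrite exprS mulrA.
elim: E => [|E IH].
  apply: eq_poly_approx (poly_approx_poly w 1) => x _.
  by rewrite expr0 hornerC.
have := poly_approxD mw w0 IH (poly_approxZ mw w0 (-1) (mulX _ N IH)).
by apply: eq_poly_approx => x _; rewrite exprS; ring.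
Qed.

Lemma poly_approx_ray (x0 : R) : poly_approx w (\1_(`]x0, +oo[%classic) : R -> R).
Proof.
apply: (poly_approx_lim mw w0
  (g_ := fun n x => (1 - expR (- h * x) ^+ n.+1) ^+ smooth_step_exponent h x0 n)
  (integrable_majorant 1)).
- by apply: measurable_indic.
- by move=> n; exact: poly_approx_pow.
- by move=> x Dx; apply: smooth_step_cvg => //; exact: in_D.
- move=> n x Dx; have x_gt0 := in_D Dx; rewrite mul1r ler_wpM2r ?w0//.
  have t01 : 0 <= 1 - expR (- h * x) ^+ n.+1 <= 1.
    rewrite subr_ge0 exprn_ile1 ?expRh_le1//= lerBlDr lerDl exprn_ge0//.
  have : 0 <= (1 - expR (- h * x) ^+ n.+1) ^+ smooth_step_exponent h x0 n <= 1.
    by case/andP: t01 => ? ?; rewrite exprn_ge0// exprn_ile1.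
  move: (_ ^+ smooth_step_exponent _ _ _) => G /andP[G0 G1].
  apply: (@le_trans _ _ 1); first by rewrite indicE; case: (_ \in _) => /=; nra.
  by rewrite -[leLHS]expR0 ler_expR mulr_ge0// ltW.
Qed.

(** The Borel sets whose indicator lies in the closure form a lambda-system; it
    contains the rays, which are stable under intersection and generate the
    Borel sets. *)
Lemma poly_approx_indic (A : set R) : measurable A ->
  poly_approx w (\1_A : R -> R).
Proof.
pose H := [set A : set R | measurable A /\ poly_approx w (\1_A : R -> R)].
suff : @measurable _ R `<=` H by move=> AH /AH [].
have -> : @measurable _ R = (@RGenOInfty.G R).-sigma.-measurable.
  exact: RGenOInfty.measurableE.
apply: lambda_system_subset => //.
- move=> _ _ [x ->] [y ->]; exists (Num.max x y).
  by apply/seteqP; split => z /=; rewrite !in_itv/= !andbT gt_max => /andP.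
- split => //.
  + split => //; apply: eq_poly_approx (poly_approx_poly w 1) => x _.
    by rewrite hornerC indicT.
  + move=> U V VU [mU aU] [mV aV]; split; first exact: measurableD.
    have := poly_approxD mw w0 aU (poly_approxZ mw w0 (-1) aV).
    apply: eq_poly_approx => x _; rewrite mulN1r !indicE.
    rewrite in_setD; case: (boolP (x \in V)) => /= xV; rewrite ?andbF ?andbT ?subr0//.
    by rewrite (mem_set (VU _ (set_mem xV))) subrr.
  + move=> F ndF HF; have mF n : measurable (F n) by apply: (HF n).1.
    have mbF : measurable (\bigcup_i F i) by exact: bigcup_measurable.
    split=> //.
    apply: (poly_approx_lim mw w0 (g_ := fun n => \1_(F n)) (integrable_majorant 1)).
    * exact: measurable_indic.
    * by move=> n; apply: (HF n).2.
    * move=> x Dx; apply: cvg_near_cst.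
      have [[n _ Fnx]|nF] := pselect ((\bigcup_i F i) x); last first.
        apply: nearW => n; rewrite !indicE (memNset nF).
        by rewrite (@memNset _ (F n))// => Fn; apply: nF; exists n.
      exists n => // k /= nk; have Fkx : F k x.
        by move/subsetPset : (ndF _ _ nk); apply.
      by rewrite !indicE (mem_set Fkx) mem_set//; exists k.
    * move=> n x Dx; have x_gt0 := in_D Dx; rewrite mul1r ler_wpM2r ?w0//.
      apply: (@le_trans _ _ 1).
        by rewrite !indicE; case: (_ \in _); case: (_ \in _) => /=; nra.
      by rewrite -[leLHS]expR0 ler_expR mulr_ge0// ltW.
- move=> _ [x ->]; split => //; exact: poly_approx_ray.
Qed.

Import HBSimple HBNNSimple.
(** The simple functions increasing to f stay within f of it, so f^2 w
    dominates. *)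
Lemma poly_approx_ge0 f : measurable_fun D f -> (forall x, D x -> 0 <= f x) ->
  mu.-integrable D (EFin \o (fun x => f x ^+ 2 * w x)) -> poly_approx w f.
Proof.
move=> mf f0 if2.
have mf' : measurable_fun D (EFin \o f) by apply/measurable_EFinP.
have mD : measurable D by [].
have f0' x : D x -> (0 <= (EFin \o f) x)%E by move=> Dx; rewrite lee_fin f0.
pose s n := nnsfun_approx mD mf' n.
apply: (poly_approx_lim mw w0 (g_ := fun n x => s n x) if2) => //.
- move=> n; rewrite [X in poly_approx _ X](funext (fimfunEord (s n))).
  apply: (poly_approx_sum mw w0) => i.
  by apply: (poly_approxZ mw w0); exact: poly_approx_indic.
- by move=> x Dx; exact: (fine_cvg (cvg_nnsfun_approx mD mf' f0' Dx)).
- move=> n x Dx; rewrite ler_wpM2r ?w0//.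
  have s0 : 0 <= s n x by [].
  have : s n x <= f x.
    by rewrite -lee_fin /s nnsfun_approxE; exact: (le_approx n f0').
  nra.
Qed.

Theorem polynomials_dense f (eps : R) : 0 < eps -> measurable_fun D f ->
  (\int[mu]_(x in D) (f x ^+ 2 * w x)%:E < +oo)%E ->
  exists p : {poly R}, (sqdist w f (horner p) < eps%:E)%E.
Proof.
move=> e0 mf fi.
have mf2 : measurable_fun D (EFin \o (fun x => f x ^+ 2 * w x)).
  by apply/measurable_EFinP; apply: measurable_funM => //; exact: measurable_funX.
have if2 : mu.-integrable D (EFin \o (fun x => f x ^+ 2 * w x)).
  apply/integrableP; split=> //; apply: le_lt_trans fi.
  rewrite le_eqVlt; apply/orP; left; apply/eqP; apply: eq_integral => x.
  by rewrite inE => Dx; rewrite gee0_abs// lee_fin mulr_ge0 ?sqr_ge0 ?w0.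
have approx_part g : measurable_fun D g -> (forall x, D x -> 0 <= g x) ->
    (forall x, `|g x| <= `|f x|) -> poly_approx w g.
  move=> mg g0 gf; apply: poly_approx_ge0 => //; apply: le_integrable if2 => //.
    by apply/measurable_EFinP; apply: measurable_funM => //; exact: measurable_funX.
  by move=> x Dx; rewrite lee_fin !normrM ler_wpM2r// ler_pM.
have ap : poly_approx w f^\+.
  apply: approx_part; [exact: measurable_funrpos| |] => x; rewrite /funrpos.
    by rewrite le_max lexx orbT.
  by case: (leP (f x) 0) => fx; rewrite ?normr0.
have an : poly_approx w f^\-.
  apply: approx_part; [exact: measurable_funrneg| |] => x; rewrite /funrneg.
    by rewrite le_max lexx orbT.
  by case: (leP (- f x) 0) => fx; rewrite ?normr0 ?normrN.
have := poly_approxD mw w0 ap (poly_approxZ mw w0 (-1) an).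
case/(eq_poly_approx (g := f)) => [x _|_]; last exact.
by rewrite mulN1r -[LHS]/((f^\+ - f^\-) x) funrposBneg.
Qed.

End PolynomialDensity.

(** * Calculus on the half-line *)

Section HalfLineCalculus.
Variable R : realType.
Local Notation mu := (@lebesgue_measure R).
Local Notation D := (`]0%R, +oo[%classic : set R).
Implicit Types f F : R -> R.

(** The index is shifted so that each interval has nonempty interior. *)
Definition half_line_exhaustion n : set R := `[n.+2%:R^-1, n.+2%:R]%classic.
Local Notation A := half_line_exhaustion.

Lemma bigcup_half_line_exhaustion : \bigcup_n A n = D.
Proof.
rewrite /half_line_exhaustion; apply/seteqP; split=> [x [n _]|x] /=; rewrite !in_itv/= andbT.
  by case/andP=> nx _; rewrite (lt_le_trans _ nx)// invr_gt0 ltr0n.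
move=> x0; exists (maxn (Num.truncn x) (Num.truncn x^-1)) => //=.
rewrite /= in_itv/=; apply/andP; split.
  rewrite -[leRHS]invrK lef_pV2 ?posrE ?invr_gt0 ?ltr0n//.
  by rewrite (le_trans (ltW (truncnS_gt _)))// ler_nat !ltnS leqW// leq_maxr.
by rewrite (le_trans (ltW (truncnS_gt _)))// ler_nat !ltnS leqW// leq_maxl.
Qed.

Lemma half_line_exhaustion_sub n : A n `<=` D.
Proof. by rewrite -bigcup_half_line_exhaustion => x; exists n. Qed.

Lemma nondecreasing_half_line_exhaustion : nondecreasing_seq A.
Proof.
move=> i j ij; apply/subsetPset => x.
rewrite /half_line_exhaustion /= !in_itv/= => /andP[ix xi].
rewrite (le_trans _ ix) ?(le_trans xi) ?ler_nat// lef_pV2 ?posrE ?ltr0n//.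
by rewrite ler_nat.
Qed.

Lemma half_line_continuous_measurable f :
  (forall x : R, 0 < x -> {for x, continuous f}) -> measurable_fun D f.
Proof.
move=> cf; apply: open_continuous_measurable_fun.
  exact: interval_open.
by move=> x; rewrite inE/= in_itv/= andbT; exact: cf.
Qed.

Lemma half_line_FTC f F (n : nat) :
  (forall x : R, 0 < x -> {for x, continuous f}) ->
  (forall x : R, 0 < x -> is_derive x (1 : R) F (f x)) ->
  (\int[mu]_(x in A n) (f x)%:E = (F n.+2%:R - F n.+2%:R^-1)%:E)%E.
Proof.
move=> cf dF.
have n0 : 0 < n.+2%:R^-1 :> R by rewrite invr_gt0 ltr0n.
have cF (x : R) : 0 < x -> F @ x --> F x.
  move=> x0; apply: differentiable_continuous; apply/derivable1_diffP.
  by have [] := dF x x0.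
rewrite EFinB; apply: continuous_FTC2.
- by rewrite (@lt_trans _ _ 1) ?invf_lt1 ?ltr1n ?ltr0n.
- apply: continuous_in_subspaceT => x; rewrite inE/= in_itv/= => /andP[nx _].
  by apply: cf; exact: lt_le_trans nx.
- split.
  + move=> x; rewrite in_itv/= => /andP[nx _].
    by have [] := dF x (lt_trans n0 nx).
  + by apply: cvg_at_right_filter; exact: cF.
  + by apply: cvg_at_left_filter; apply: cF; rewrite ltr0n.
- move=> x; rewrite in_itv/= => /andP[nx _]; rewrite derive1E.
  by have [_ ->] := dF x (lt_trans n0 nx).
Qed.

(** A nonnegative function with a bounded primitive is integrable, by monotone
    convergence along the exhaustion. *)
Lemma half_line_integrable f F (M : R) :
  (forall x : R, 0 < x -> 0 <= f x) ->
  (forall x : R, 0 < x -> {for x, continuous f}) ->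
  (forall x : R, 0 < x -> is_derive x (1 : R) F (f x)) ->
  (forall x : R, 0 < x -> `|F x| <= M) ->
  mu.-integrable D (EFin \o f).
Proof.
move=> f0 cf dF FM.
have mf : measurable_fun D (EFin \o f).
  by apply/measurable_EFinP; exact: half_line_continuous_measurable.
apply/integrableP; split=> //.
have -> : (\int[mu]_(x in D) `|(EFin \o f) x| =
           \int[mu]_(x in D) (EFin \o f) x)%E.
  apply: eq_integral => x; rewrite inE/= in_itv/= andbT => x0.
  by rewrite /= ger0_norm ?f0.
apply: (@le_lt_trans _ _ (2 * M)%:E); last exact: ltry.
have cvgI : (fun n => \int[mu]_(x in A n) (f x)%:E)%E @ \oo -->
    (\int[mu]_(x in \bigcup_n A n) (f x)%:E)%E.
  apply: ge0_nondecreasing_set_cvg_integral => //.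
  - exact: nondecreasing_half_line_exhaustion.
  - by move=> n; exact: measurable_itv.
  - by move=> n; apply: measurable_funS mf => //; exact: half_line_exhaustion_sub.
  - move=> n x /half_line_exhaustion_sub; rewrite /= in_itv/= andbT => x0.
    by rewrite lee_fin f0.
rewrite bigcup_half_line_exhaustion in cvgI.
apply: (@cvge_to_le _ _ _ _ _ _ _ cvgI).
apply: nearW => n; rewrite (half_line_FTC n cf dF) lee_fin.
rewrite mulr_natl mulr2n (le_trans (ler_norm _))// (le_trans (ler_normB _ _))//.
by rewrite lerD// FM// ?invr_gt0 ltr0n.
Qed.

(** As f may change sign, dominated convergence along the exhaustion replaces
    monotone convergence. *)
Lemma half_line_integral0 f F :
  mu.-integrable D (EFin \o f) ->
  (forall x : R, 0 < x -> {for x, continuous f}) ->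
  (forall x : R, 0 < x -> is_derive x (1 : R) F (f x)) ->
  (fun n => F n.+2%:R) @ \oo --> 0 ->
  (fun n => F n.+2%:R^-1) @ \oo --> 0 ->
  (\int[mu]_(x in D) (f x)%:E = 0)%E.
Proof.
move=> if_ cf dF Foo F0.
have mD : measurable D by [].
have mf : measurable_fun D (EFin \o f) by case/integrableP: if_.
have IA n : (\int[mu]_(x in A n) (f x)%:E =
    \int[mu]_(x in D) ((EFin \o f) \_ (A n)) x)%E.
  rewrite -integral_mkcondr; congr (integral _ _ _).
  by apply/esym/setIidPr; exact: half_line_exhaustion_sub.
have lim1 : (fun n => \int[mu]_(x in D) ((EFin \o f) \_ (A n)) x)%E @ \oo --> 0%E.
  under eq_fun do rewrite -IA (half_line_FTC _ cf dF).
  by apply: cvg_EFin; [exact: nearW|rewrite -(subrr 0); apply: cvgB].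
have [|||||_ _ lim2] := @dominated_convergence _ _ _ mu D mD
  (fun n => (EFin \o f) \_ (A n)) (EFin \o f) (abse \o EFin \o f).
- move=> n; apply/measurable_restrict => //; first exact: measurable_itv.
  by apply: measurable_funS mf => //; exact: subIsetr.
- exact: mf.
- apply: aeW => x; rewrite -bigcup_half_line_exhaustion => -[n _ nx].
  apply: cvg_near_cst; exists n => // k /= nk; rewrite patchE mem_set//.
  by move/subsetPset : (nondecreasing_half_line_exhaustion nk); apply.
- exact: integrable_abse if_.
- apply: aeW => x n Dx; rewrite patchE; case: ifP => // _.
  by rewrite abse0 /= lee_fin normr_ge0.
exact: cvg_unique lim2 lim1.
Qed.

End HalfLineCalculus.

Lemma is_derive_inv (R : realType) (f : R -> R) (x df : R) : f x != 0 ->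
  is_derive x 1 f df -> is_derive x 1 (fun y => (f y)^-1) (- (df / f x ^+ 2)).
Proof.
move=> fx0 [dfx <-]; split; first exact: derivableV.
by rewrite deriveV// scaleNr /GRing.scale /= mulrC.
Qed.

Lemma is_derive_continuous (R : realType) (f : R -> R) (x df : R) :
  is_derive x 1 f df -> {for x, continuous f}.
Proof.
by move=> [dfx _]; apply: differentiable_continuous; exact/derivable1_diffP.
Qed.

Lemma powRS (R : realType) (x a : R) : 0 < x -> x `^ (a + 1) = x * x `^ a.
Proof.
move=> x0; rewrite powRD; last by rewrite (@gt_eqF _ _ x)// implybT.
by rewrite powRr1 ?ltW// mulrC.
Qed.

(** Up to a constant factor, the integrand is dominated by the derivative of the
    bounded function -1/(1 + x^(a+1)). *)
Lemma powR_expR_integrable (R : realType) (a d : R) : -1 < a < 0 -> 0 < d ->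
  (@lebesgue_measure R).-integrable `]0, +oo[
    (EFin \o (fun x => x `^ a * expR (- (d * x)))).
Proof.
move=> /andP[a1 a0] d0; pose b := a + 1; have b0 : 0 < b by rewrite /b; lra.
have dpow (x : R) : 0 < x -> is_derive x 1 (fun y => y `^ b) (b * x `^ a).
  by move=> x0; have := is_derive1_powR b x0; rewrite /b addrK.
have p1 (x : R) : 0 < 1 + x `^ b by rewrite ltr_pwDl ?powR_ge0.
have dq (x : R) : 0 < x -> is_derive x 1 (fun y => 1 + y `^ b) (b * x `^ a).
  move=> x0; rewrite -[X in is_derive _ _ _ X]add0r.
  by apply: is_deriveD; exact: dpow.
have dF (x : R) : 0 < x -> is_derive x 1 (fun y => - (1 + y `^ b)^-1)
    (b * x `^ a / (1 + x `^ b) ^+ 2).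
  move=> x0; rewrite -[X in is_derive _ _ _ X]opprK.
  by apply: is_deriveN; apply: is_derive_inv; [rewrite gt_eqF|exact: dq].
have major : (@lebesgue_measure R).-integrable `]0, +oo[
    (EFin \o (fun x => b * x `^ a / (1 + x `^ b) ^+ 2)).
  apply: (half_line_integrable (M := 1) _ _ dF) => x x0.
  - by rewrite divr_ge0 ?sqr_ge0// mulr_ge0 ?powR_ge0// ltW.
  - apply: cvgM; first apply: cvgM; first exact: cvg_cst.
      exact: is_derive_continuous (is_derive1_powR a x0).
    have q0 : 1 + x `^ b != 0 by rewrite gt_eqF.
    have cq := is_derive_continuous (dq x x0).
    by apply: cvgV; [rewrite expf_neq0|exact: cvgM].
  - by rewrite normrN ger0_norm ?invr_ge0 ?invf_le1 ?lerDl ?powR_ge0// ltW.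
have [M M0 HM] := horner_le_expR ((2%:P + 'X) ^+ 2) d0.
have iM := @integrableZl _ _ R lebesgue_measure `]0, +oo[ ltac:(by []) (M / b) _ major.
apply: le_integrable iM => //.
- apply/measurable_EFinP; apply: measurable_funTS; apply: measurable_funM.
    exact: measurable_powR.
  by apply: measurableT_comp => //; apply: measurableT_comp => //; exact: measurable_funM.
- move=> x; rewrite /= in_itv/= andbT => x0.
  rewrite lee_fin !ger0_norm; last 2 first.
  + by rewrite !mulr_ge0 ?invr_ge0 ?sqr_ge0 ?powR_ge0// ltW.
  + by rewrite !mulr_ge0 ?expR_ge0 ?powR_ge0.
  rewrite (_ : M / b * _ = x `^ a * (M / (1 + x `^ b) ^+ 2)); last first.
    by field; rewrite !gt_eqF.
  rewrite ler_wpM2l ?powR_ge0// expRN ler_pdivlMr ?exprn_gt0//.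
  rewrite mulrC ler_pdivrMr ?expR_gt0//.
  apply: le_trans (HM x (ltW x0)); apply: le_trans (ler_norm _).
  rewrite !hornerE lerXn2r ?nnegrE ?addr_ge0 ?powR_ge0 ?(ltW x0)//.
  rewrite (_ : 2 + x = 1 + (1 + x)) ?lerD2l; last by ring.
  have [x1|x1] := leP x 1; last first.
    by rewrite (le_trans (ler1_powR (ltW x1) _)) ?lerDr// /b; lra.
  apply: (@le_trans _ _ 1); last by rewrite lerDl (ltW x0).
  by rewrite -(powRr0 x) ger_powR ?x0 ?(ltW b0).
Qed.

(** * The exceptional weight *)

Section ExceptionalWeight.
Variables (R : realType) (m : nat) (alpha : R).
Hypothesis halpha : -1 < alpha < 0.
Local Notation mu := (@lebesgue_measure R).
Local Notation D := (`]0%R, +oo[%classic : set R).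
Local Notation W := (XIII_weight m alpha).
Local Notation eta := (reflected_laguerre (- alpha - 1) m).

Let eta_param : -1 < - alpha - 1. Proof. by have := halpha; lra. Qed.

Let eta_inf := gbinom (m%:R + (- alpha - 1)) m.
Let eta_inf_gt0 : 0 < eta_inf. Proof. exact: gbinom_natD_gt0. Qed.
Let eta_ge x : 0 <= x -> eta_inf <= eta.[x].
Proof. exact: reflected_laguerre_ge. Qed.

Lemma XIII_denominator_gt0 x : 0 <= x -> 0 < eta.[x].
Proof. by move=> x0; exact: lt_le_trans (eta_ge x0). Qed.

Lemma XIII_weightE x : W x = x `^ alpha * expR (- x) / eta.[x] ^+ 2.
Proof. by rewrite /reflected_laguerre horner_comp hornerN hornerX. Qed.

Lemma XIII_weight_gt0 x : 0 < x -> 0 < W x.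
Proof.
move=> x0; rewrite XIII_weightE divr_gt0 ?exprn_gt0 ?XIII_denominator_gt0 ?ltW//.
by rewrite mulr_gt0 ?powR_gt0 ?expR_gt0.
Qed.

Lemma is_derive_expRN (x : R) : is_derive x 1 (fun y => expR (- y)) (- expR (- x)).
Proof.
rewrite -mulrN1.
exact: (is_derive1_comp (is_derive_expR (- x)) (is_deriveNid x 1)).
Qed.

Lemma XIII_weight_continuous (x : R) : 0 < x -> {for x, continuous W}.
Proof.
move=> x0; rewrite (funext XIII_weightE).
have eta0 : eta.[x] != 0 by rewrite gt_eqF// XIII_denominator_gt0// ltW.
apply: cvgM; first apply: cvgM.
- exact: is_derive_continuous (is_derive1_powR alpha x0).
- exact: is_derive_continuous (is_derive_expRN x).
- apply: cvgV; first by rewrite expf_neq0.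
  have -> : (fun y => eta.[y] ^+ 2) = horner (eta ^+ 2).
    by apply/funext => y; rewrite horner_exp.
  by rewrite -[eta.[x] ^+ 2]horner_exp; exact: continuous_horner.
Qed.

Lemma XIII_weight_measurable : measurable_fun D W.
Proof.
by apply: half_line_continuous_measurable => x x0; exact: XIII_weight_continuous.
Qed.

(** eta is bounded below, and half of e^{-x} absorbs the polynomial. *)
Lemma horner_weight_le (p : {poly R}) : exists2 C, 0 <= C & forall x, 0 < x ->
  `|p.[x] * W x| <= C * (x `^ alpha * expR (- (2^-1 * x))).
Proof.
have h0 : 0 < 2^-1 :> R by [].
have [M M0 HM] := horner_le_expR p h0.
exists (M / eta_inf ^+ 2) => [|x x0]; first by rewrite divr_ge0 ?sqr_ge0.
rewrite normrM (gtr0_norm (XIII_weight_gt0 x0)) XIII_weightE.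
rewrite [leRHS](_ : _ = (M * expR (2^-1 * x)) *
    (x `^ alpha * expR (- x) / eta_inf ^+ 2)); last first.
  rewrite (_ : - (2^-1 * x) = 2^-1 * x + - x); last by field.
  by rewrite expRD; field; rewrite gt_eqF.
apply: ler_pM => //.
- by rewrite divr_ge0 ?sqr_ge0// mulr_ge0 ?powR_ge0 ?expR_ge0.
- exact/HM/ltW.
- rewrite ler_wpM2l ?mulr_ge0 ?powR_ge0 ?expR_ge0// lef_pV2 ?posrE ?exprn_gt0//.
    by rewrite lerXn2r ?nnegrE ?eta_ge// ltW// XIII_denominator_gt0// ltW.
  by rewrite XIII_denominator_gt0// ltW.
Qed.

Lemma horner_weight_integrable (p : {poly R}) :
  mu.-integrable D (EFin \o (fun x => p.[x] * W x)).
Proof.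
have [C C0 HC] := horner_weight_le p.
have h0 : 0 < 2^-1 :> R by [].
have iC := @integrableZl _ _ R mu D ltac:(by []) C _ (powR_expR_integrable halpha h0).
apply: le_integrable iC => //.
- apply/measurable_EFinP; apply: measurable_funM; first exact: measurable_horner.
  exact: XIII_weight_measurable.
- move=> x; rewrite /= in_itv/= andbT => x0; rewrite lee_fin.
  exact: le_trans (HC x x0) (ler_norm _).
Qed.

(** The derivative of x^(alpha+1) e^{-x} P / eta is minus the weight times this
    polynomial. *)
Definition XIII_flux (P : {poly R}) : {poly R} :=
  P * ('X * eta^`() + ('X - (alpha + 1)%:P) * eta) - 'X * P^`() * eta.

Let primitive (P : {poly R}) x := x `^ (alpha + 1) * expR (- x) * (P.[x] / eta.[x]).

Let is_derive_primitive P (x : R) : 0 < x ->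
  is_derive x 1 (primitive P) (- (XIII_flux P).[x] * W x).
Proof.
move=> x0; have eta0 : eta.[x] != 0 by rewrite gt_eqF// XIII_denominator_gt0// ltW.
have d1 := is_deriveM (is_derive1_powR (alpha + 1) x0) (is_derive_expRN x).
have d2 := is_deriveM (is_derive_poly P x) (is_derive_inv eta0 (is_derive_poly eta x)).
apply: (is_derive_eq (is_deriveM d1 d2)).
rewrite !mulrfctE /GRing.scale /= addrK powRS// XIII_weightE /XIII_flux.
rewrite !(hornerD, hornerN, hornerM, hornerX, hornerC).
by field.
Qed.

(** The primitive x^(alpha+1) e^{-x} P / eta vanishes at both ends: at 0
    because alpha + 1 > 0, at infinity because of the exponential. *)
Lemma integral_flux0 (P : {poly R}) :
  (\int[mu]_(x in D) ((XIII_flux P).[x] * W x)%:E = 0)%E.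
Proof.
have dN (x : R) : 0 < x ->
    is_derive x 1 (primitive (- P)) ((XIII_flux P).[x] * W x).
  have -> : (XIII_flux P).[x] = - (XIII_flux (- P)).[x].
    by rewrite -hornerN /XIII_flux derivN; congr (_.[x]); ring.
  exact: is_derive_primitive.
have h0 : 0 < 2^-1 :> R by [].
have [M M0 HM] := horner_le_expR (- P) h0; pose K := M / eta_inf.
have K0 : 0 <= K by rewrite divr_ge0// ltW.
have prim_le (x : R) : 0 < x ->
    `|primitive (- P) x| <= K * (x `^ (alpha + 1) * expR (- (2^-1 * x))).
  move=> x0; have eta0 := XIII_denominator_gt0 (ltW x0).
  rewrite /primitive !normrM normfV (gtr0_norm eta0).
  rewrite (ger0_norm (powR_ge0 _ _)) (ger0_norm (expR_ge0 _)).
  rewrite [leRHS](_ : _ = x `^ (alpha + 1) * expR (- x) *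
    ((M * expR (2^-1 * x)) / eta_inf)); last first.
    rewrite (_ : - (2^-1 * x) = 2^-1 * x + - x); last by field.
    by rewrite expRD /K; field; rewrite gt_eqF.
  rewrite ler_wpM2l ?mulr_ge0 ?powR_ge0 ?expR_ge0//.
  by rewrite ler_pM ?invr_ge0 ?(ltW eta0) ?HM ?(ltW x0)// lef_pV2 ?posrE ?eta_ge ?(ltW x0).
clearbody K; apply: (half_line_integral0 (F := primitive (- P))) => //.
- exact: horner_weight_integrable.
- move=> x x0; apply: cvgM; first exact: continuous_horner.
  exact: XIII_weight_continuous.
- apply: (@cvg_le_harmonic _ _ _ (K * 8)) => n; rewrite sub0r normrN.
  have x1 : 1 <= n.+2%:R :> R by rewrite ler1n.
  have x0 : 0 < n.+2%:R :> R by rewrite ltr0n.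
  apply: le_trans (prim_le _ x0) _; rewrite -mulrA ler_wpM2l//.
  apply: (@le_trans _ _ (8 / n.+2%:R)); last first.
    by rewrite ler_wpM2l// lef_pV2 ?posrE ?ltr0n// ler_nat.
  (* x e^{-x/2} <= 8/x, from e^y >= 1 + y^2/2 at y = x/2. *)
  have y0 : 0 <= 2^-1 * n.+2%:R :> R by rewrite mulr_ge0// ltW.
  have := expR_ge1Dxn 1 y0; rewrite (_ : 2`!%:R = 2%:R)// => ey.
  apply: (@le_trans _ _ (n.+2%:R * expR (- (2^-1 * n.+2%:R)))).
    by rewrite ler_wpM2r ?expR_ge0// ler1_powR//; have := halpha; lra.
  rewrite expRN ler_pdivrMr ?expR_gt0// mulrAC ler_pdivlMr// -ler_pdivrMl//.
  apply: le_trans ey; rewrite -[leLHS]add0r lerD//.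
  by rewrite le_eqVlt; apply/orP; left; apply/eqP; field.
- have pow0 : (fun n => n.+2%:R^-1 `^ (alpha + 1)) @ \oo --> (0 : R).
    have a1 : 0 < alpha + 1 by have := halpha; lra.
    have /cvg_at_rightP := powR_cvg0 a1; apply; split=> [n|].
      by rewrite invr_gt0 ltr0n.
    apply: (@cvg_le_harmonic _ _ _ 1) => n; rewrite sub0r normrN mul1r.
    by rewrite ger0_norm ?invr_ge0// lef_pV2 ?posrE ?ltr0n// ler_nat.
  have Kpow0 : (fun n => K * n.+2%:R^-1 `^ (alpha + 1)) @ \oo --> (0 : R).
    by rewrite -(mulr0 K); apply: cvgM => //; exact: cvg_cst.
  apply/norm_cvg0P; apply: (squeeze_cvgr _ (cvg_cst 0) Kpow0).
  apply: nearW => n; rewrite normr_ge0/= (le_trans (prim_le _ _)) ?invr_gt0 ?ltr0n//.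
  rewrite ler_wpM2l// ler_piMr ?powR_ge0// expR_le1 oppr_le0 mulr_ge0//.
Qed.

End ExceptionalWeight.

(** * Orthogonality and completeness *)

Local Open Scope complex_scope.

Lemma XIII_fluxE (R : realType) m (alpha : R) k :
  XIII_flux m alpha (laguerre_nat (alpha + 1) k) = XIII_laguerre m alpha (m.+1 + k).
Proof. by rewrite XIII_laguerreE. Qed.

Lemma XIII_fluxZ (R : realType) m (alpha a : R) P :
  XIII_flux m alpha (a *: P) = a *: XIII_flux m alpha P.
Proof. by rewrite /XIII_flux derivZ -!mul_polyC; ring. Qed.

(** phi is n u_k for n = m + 1 + k, and 0 for n = 0. These are the two
    first-order relations equivalent to the Sturm-Liouville equation. *)
Lemma XIII_index_flux (R : realType) m (alpha : R) n : XIII_index m n ->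
  exists2 phi, XIII_flux m alpha phi = n%:R *: XIII_laguerre m alpha n
             & (XIII_laguerre m alpha n)^`() = reflected_laguerre (- alpha - 1) m * phi.
Proof.
case=> [->|mn]; [exists 0|exists (n%:R *: laguerre_nat (alpha + 1) (n - m.+1))].
- by rewrite /XIII_flux deriv0 scale0r; ring.
- by rewrite mulr0 derivC.
- by rewrite XIII_fluxZ XIII_fluxE subnKC.
- have := deriv_XIII_laguerre alpha m (n - m.+1); rewrite subnKC// => ->.
  exact: scalerAr.
Qed.

(** Lagrange's identity, for P = phi_n L_k - phi_k L_n: the terms with
    phi_n phi_k cancel. *)
Lemma XIII_flux_wronskian (R : realType) m (alpha : R) n k :
  XIII_index m n -> XIII_index m k ->
  exists P, XIII_flux m alpha P =
    (n%:R - k%:R) *: (XIII_laguerre m alpha n * XIII_laguerre m alpha k).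
Proof.
move=> /(XIII_index_flux alpha)[u Fu du] /(XIII_index_flux alpha)[v Fv dv].
move: Fu Fv du dv; set L := XIII_laguerre _ _ n; set M := XIII_laguerre _ _ k.
move=> Fu Fv du dv; exists (u * M - v * L).
transitivity (XIII_flux m alpha u * M - XIII_flux m alpha v * L).
  by rewrite /XIII_flux derivB !derivM du dv; ring.
by rewrite Fu Fv scalerBl -!mul_polyC; ring.
Qed.

Lemma XIII_laguerre_neq0 (R : realType) m (alpha : R) n :
  -1 < alpha < 0 -> XIII_index m n -> XIII_laguerre m alpha n != 0.
Proof.
move=> halpha [->|mn]; first exact: oner_neq0.
apply/eqP => L0; have := deriv_XIII_laguerre alpha m (n - m.+1).
rewrite subnKC// L0 deriv0 => /esym/eqP; rewrite scaler_eq0 mulf_eq0.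
rewrite pnatr_eq0 gtn_eqF ?(leq_trans _ mn)//=.
rewrite -size_poly_eq0 -size_poly_eq0 size_laguerre_nat orbF size_poly_eq0.
move=> /eqP eta0; have := XIII_denominator_gt0 m halpha (lexx 0).
by rewrite eta0 horner0 ltxx.
Qed.

Section WeightedInner.
Variables (R : realType) (W : R -> R).
Local Notation mu := (@lebesgue_measure R).
Local Notation D := (`]0%R, +oo[%classic : set R).

Lemma normc_sqr (z : R[i]) : Normc.normc z ^+ 2 = complex.Re z ^+ 2 + complex.Im z ^+ 2.
Proof. by case: z => a b /=; rewrite sqr_sqrtr// addr_ge0 ?sqr_ge0. Qed.

Lemma L2sqnorm_poly (p : {poly R}) : L2sqnorm W (poly_Cfun p) =
  (\int[mu]_(x in D) ((p * p).[x] * W x)%:E)%E.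
Proof.
apply: eq_integral => x _; rewrite normc_sqr /= expr0n addr0.
by rewrite hornerM expr2.
Qed.

Lemma L2inner_poly (p q : {poly R}) :
  (\int[mu]_(x in D) ((p * q).[x] * W x)%:E = 0)%E ->
  L2inner W (poly_Cfun p) (poly_Cfun q) = 0.
Proof.
move=> pq0; rewrite /L2inner /Rintegral.
rewrite [X in fine X +i* _](_ : _ = 0%E); last first.
  rewrite -pq0; apply: eq_integral => x _; rewrite hornerM /poly_Cfun /=.
  by congr ((_ * _)%:E); ring.
rewrite integral0_eq//= => x _; rewrite /poly_Cfun /=.
by rewrite !(mulr0, mul0r, oppr0, addr0).
Qed.

(** Beyond the roots of p the integrand is positive on a whole interval. *)
Lemma integral_sqr_poly_gt0 (p : {poly R}) : p != 0 ->
  measurable_fun D W -> (forall x, 0 < x -> 0 < W x) ->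
  (0 < \int[mu]_(x in D) ((p * p).[x] * W x)%:E)%E.
Proof.
move=> p0 mW W0; have mD : measurable D by [].
pose F x := ((p * p).[x] * W x)%:E.
have F0 x : D x -> (0 <= F x)%E.
  rewrite /= in_itv/= andbT => x0.
  by rewrite lee_fin hornerM -expr2 mulr_ge0 ?sqr_ge0// ltW// W0.
have mF : measurable_fun D F.
  by apply/measurable_EFinP; apply: measurable_funM => //; exact: measurable_horner.
rewrite lt_neqAle integral_ge0// andbT; apply/negP => /eqP/esym I0.
have /(ae_eq_integral_abs mu mD mF)[N [mN N0 sub]] :
    (\int[mu]_(x in D) `|F x| = 0)%E.
  rewrite -[RHS]I0; apply: eq_integral => x; rewrite inE => Dx.
  by rewrite gee0_abs// F0.
pose a := Num.max (cauchy_bound p) 0.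
have aN : `]a, a + 1[%classic `<=` N.
  move=> x /=; rewrite in_itv/= => /andP[ax _]; apply: sub => /=.
  have x0 : 0 < x by apply: le_lt_trans ax; rewrite le_max lexx orbT.
  have bx : cauchy_bound p < x by apply: le_lt_trans ax; rewrite le_max lexx.
  move=> /(_ _)/eqP; rewrite in_itv/= andbT => /(_ x0).
  rewrite /F eqe mulf_eq0 (gt_eqF (W0 _ x0)) orbF hornerM mulf_eq0 orbb.
  move=> /eqP px; have := cauchy_boundP p0 px.
  by rewrite gtr0_norm// => /(lt_trans bx); rewrite ltxx.
have : (mu `]a, (a + 1)%R[ <= mu N)%E.
  by apply: le_measure => //; rewrite inE.
by rewrite N0 lebesgue_measure_itv/= lte_fin ltrDl ltr01 -EFinD addrAC subrr add0r lee_fin ler10.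
Qed.

End WeightedInner.

Lemma XIII_orthogonal (R : realType) (m : nat) (alpha : R) : -1 < alpha < 0 ->
  orthogonal_family (XIII_weight m alpha) (XIII_index m)
    (fun n => poly_Cfun (XIII_laguerre m alpha n)).
Proof.
move=> halpha; split=> [n _|n mn|n k mn mk nk].
- split; [exact: measurable_horner|exact: measurable_cst|].
  rewrite L2sqnorm_poly; apply: integrable_lty => //.
  exact: horner_weight_integrable.
- rewrite L2sqnorm_poly integral_sqr_poly_gt0 ?XIII_laguerre_neq0//.
    exact: XIII_weight_measurable.
  by move=> x; exact: XIII_weight_gt0.
- apply: L2inner_poly; have [P FP] := XIII_flux_wronskian alpha mn mk.
  have nk0 : n%:R - k%:R != 0 :> R by rewrite subr_eq0 eqr_nat; apply/eqP.
  have := integral_flux0 m halpha ((n%:R - k%:R)^-1 *: P).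
  by rewrite XIII_fluxZ FP scalerA mulVf// scale1r.
Qed.

Lemma sum_complexE (R : realType) N (c d p : 'I_N -> R) :
  \sum_(i < N) (c i +i* d i) * (p i)%:C =
  (\sum_(i < N) c i * p i) +i* (\sum_(i < N) d i * p i).
Proof.
elim: N c d p => [|N IH] c d p; first by rewrite !big_ord0.
rewrite !big_ord_recl IH; apply/eqP; rewrite eq_complex /=.
by rewrite !mulr0 subr0 add0r !eqxx.
Qed.

(** Approximating f by eta^2 p in the weight W is approximating f / eta^2 by p
    in the weight eta^4 W. *)
Lemma XIII_dense_multiples (R : realType) (m : nat) (alpha : R) (f : R -> R) (eps : R)
    (eta := reflected_laguerre (- alpha - 1) m)
    (D := `]0%R, +oo[%classic : set R) :
  -1 < alpha < 0 -> 0 < eps -> measurable_fun D f ->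
  (\int[lebesgue_measure]_(x in D)
     (f x ^+ 2 * XIII_weight m alpha x)%:E < +oo)%E ->
  exists p : {poly R}, (\int[lebesgue_measure]_(x in D)
     ((f x - (eta ^+ 2 * p)%R.[x]) ^+ 2 * XIII_weight m alpha x)%:E < eps%:E)%E.
Proof.
move=> halpha e0 mf fi; have mD : measurable D by exact: measurable_itv.
pose W := XIII_weight m alpha.
pose w x := (eta ^+ 4).[x] * W x.
have in_D x : D x -> 0 < x by rewrite /D /= in_itv/= andbT.
have eta0 x : D x -> eta.[x] != 0.
  by move=> /in_D x0; rewrite gt_eqF// XIII_denominator_gt0// ltW.
have W0 x : D x -> 0 <= W x by move=> /in_D x0; rewrite ltW// XIII_weight_gt0.
have w0 x : D x -> 0 <= w x.
  by move=> Dx; rewrite mulr_ge0 ?W0// horner_exp exprn_even_ge0.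
have mW : measurable_fun D W by exact: XIII_weight_measurable.
have mw : measurable_fun D w by apply: measurable_funM => //; exact: measurable_horner.
have c0 : 0 < 4^-1 :> R by [].
have iw : (@lebesgue_measure R).-integrable D (fun x => (expR (4^-1 * x) * w x)%:E).
  have [C C0 HC] := horner_weight_le m halpha (eta ^+ 4).
  have iC := @integrableZl _ _ R lebesgue_measure D (measurable_itv _) C _ (powR_expR_integrable halpha c0).
  apply: le_integrable iC => //.
    apply/measurable_EFinP; apply: measurable_funM => //.
    by apply: measurableT_comp => //; exact: measurable_funM.
  move=> x Dx; rewrite /= lee_fin normrM (ger0_norm (expR_ge0 _)).
  apply: le_trans (ler_norm _).
  apply: (@le_trans _ _ (expR (4^-1 * x) * (C * (x `^ alpha * expR (- (2^-1 * x)))))).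
    by rewrite ler_wpM2l ?expR_ge0 ?HC ?in_D.
  rewrite (_ : - (4^-1 * x) = 4^-1 * x + - (2^-1 * x)); last by field.
  by rewrite expRD le_eqVlt; apply/orP; left; apply/eqP; ring.
have mg : measurable_fun D (fun x => f x / eta.[x] ^+ 2).
  apply: measurable_funM => //; apply: half_line_continuous_measurable => x x0.
  have Dx : D x by rewrite /D /= in_itv/= andbT.
  apply: is_derive_continuous; apply: is_derive_inv.
  by rewrite expf_neq0// eta0.
have gE x p : D x ->
    (f x / eta.[x] ^+ 2 - p) ^+ 2 * w x = (f x - eta.[x] ^+ 2 * p) ^+ 2 * W x.
  by move=> Dx; rewrite /w horner_exp; field; exact: eta0.
have gi : (\int[lebesgue_measure]_(x in D) ((f x / eta.[x] ^+ 2) ^+ 2 * w x)%:E < +oo)%E.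
  congr (_ < _)%E : fi; apply: eq_integral => x; rewrite inE => Dx.
  by have := gE x 0 Dx; rewrite mulr0 !subr0 => ->.
have [p Hp] := polynomials_dense mw w0 c0 iw e0 mg gi; exists p.
congr (_ < _)%E : Hp; apply: eq_integral => x; rewrite inE => Dx.
by rewrite hornerM horner_exp gE.
Qed.

(** The length of the expansion can be taken arbitrarily large, so that the
    real and imaginary parts can share one index set. *)
Lemma XIII_multiple_expansion (R : realType) (m : nat) (alpha : R) (p : {poly R})
    (eta := reflected_laguerre (- alpha - 1) m) :
  exists N, forall M, (N <= M)%N -> exists c : nat -> R, eta ^+ 2 * p =
    \sum_(i < M.+1) c i *: XIII_laguerre m alpha (XIII_enum m i).
Proof.
(* (eta^2 p)' = eta q. *)
pose q := eta^`() * p *+ 2 + eta * p^`(); exists (size q) => M qM.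
apply: (XIII_laguerre_span qM).
by rewrite derivM expr2 derivM /q -/eta mulr2n; ring.
Qed.

Lemma L2sqnormE (R : realType) (W : R -> R) (f : R -> R[i]) (p q : R -> R)
    (D := `]0%R, +oo[%classic : set R) :
  measurable_fun D W -> (forall x, D x -> 0 <= W x) ->
  measurable_fun D p -> measurable_fun D q -> f = (fun x => p x +i* q x) ->
  (L2sqnorm W f = \int[lebesgue_measure]_(x in D) (p x ^+ 2 * W x)%:E
              + \int[lebesgue_measure]_(x in D) (q x ^+ 2 * W x)%:E)%E.
Proof.
move=> mW W0 mp mq ->; have mD : measurable D by exact: measurable_itv.
have msq (h : R -> R) : measurable_fun D h ->
    measurable_fun D (fun x => (h x ^+ 2 * W x)%:E).
  by move=> mh; apply/measurable_EFinP; apply: measurable_funM => //; exact: measurable_funX.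
have sq0 (h : R -> R) x : D x -> (0 <= (h x ^+ 2 * W x)%:E)%E.
  by move=> Dx; rewrite lee_fin mulr_ge0 ?sqr_ge0 ?W0.
rewrite -ge0_integralD//; [|exact: (sq0 p)|exact: (msq p)|exact: (sq0 q)|exact: (msq q)].
by apply: eq_integral => x _; rewrite normc_sqr /= mulrDl EFinD.
Qed.

Theorem theorem5p4 (R : realType) (m : nat) (alpha : R)
    (hm : (1 <= m)%N) (halpha : -1 < alpha < 0) :
  let W := XIII_weight m alpha in
  let e := fun n : nat => poly_Cfun (XIII_laguerre m alpha n) in
  orthogonal_family W (XIII_index m) e /\
  L2complete W [set e n | n in XIII_index m].
Proof.
move=> W e; split; first exact: XIII_orthogonal.
move=> f [mRe mIm fi] eps e0.
pose D := `]0%R, +oo[%classic : set R.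
have mW : measurable_fun D W by exact: XIII_weight_measurable.
have W0 x : D x -> 0 <= W x.
  by rewrite /D /= in_itv/= andbT => x0; rewrite ltW// XIII_weight_gt0.
have fE : f = (fun x => complex.Re (f x) +i* complex.Im (f x)).
  by apply/funext => x; case: (f x).
rewrite (L2sqnormE mW W0 mRe mIm fE) in fi.
have sq0 (h : R -> R) : (0 <= \int[lebesgue_measure]_(x in D) (h x ^+ 2 * W x)%:E)%E.
  by apply: integral_ge0 => x Dx; rewrite lee_fin mulr_ge0 ?sqr_ge0 ?W0.
have fRe : (\int[lebesgue_measure]_(x in D) (complex.Re (f x) ^+ 2 * W x)%:E < +oo)%E.
  by apply: le_lt_trans fi; rewrite leeDl// sq0.
have fIm : (\int[lebesgue_measure]_(x in D) (complex.Im (f x) ^+ 2 * W x)%:E < +oo)%E.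
  by apply: le_lt_trans fi; rewrite leeDr// sq0.
have e2 : 0 < eps ^+ 2 / 2 by rewrite divr_gt0// exprn_gt0.
have [p Hp] := XIII_dense_multiples halpha e2 mRe fRe.
have [q Hq] := XIII_dense_multiples halpha e2 mIm fIm.
have [Np ep] := XIII_multiple_expansion m alpha p.
have [Nq eq] := XIII_multiple_expansion m alpha q.
have [c Ec] := ep _ (leq_maxl Np Nq); have [d Ed] := eq _ (leq_maxr Np Nq).
set M := (maxn Np Nq).+1 in Ec Ed *.
exists (fun x => \sum_(i < M) (c i +i* d i) * e (XIII_enum m i) x).
  exists M, (fun i => c i +i* d i), (fun i => e (XIII_enum m i)); split=> // i.
  by exists (XIII_enum m i) => //; exact: XIII_enumP.
set r := _ ^+ 2 * p in Hp Ec; set s := _ ^+ 2 * q in Hq Ed.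
rewrite (@L2sqnormE _ _ _ (fun x => complex.Re (f x) - r.[x])
  (fun x => complex.Im (f x) - s.[x]))//; last 3 first.
- by apply: measurable_funB => //; exact: measurable_horner.
- by apply: measurable_funB => //; exact: measurable_horner.
- apply/funext => x; rewrite sum_complexE Ec Ed !horner_sum.
  under eq_bigr do rewrite -hornerZ.
  under [X in _ - (_ +i* X)]eq_bigr do rewrite -hornerZ.
  by case: (f x).
by rewrite [eps ^+ 2](splitr) EFinD lteD.
Qed.
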